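(* For $k\ge1$, $$W_{111\text{-}1}(x;k)=\sum_{j=1}^k\frac{(k-j)!\binom{k}{j}\bigl(1+x(1+x)+\delta_{j,1}x^3\bigr)x^{3(k-j)}}{\prod_{i=j}^k\bigl(1-(i-1)x(1+x)\bigr)},$$ where $\delta_{j,1}$ is the Kronecker delta.
   Context: For $k\ge1$ let $[k]=\{1,\dots,k\}$; a $k$-ary word of length $n$ is an element of $[k]^n$. A word $w=w_1\cdots w_n$ contains the vincular pattern $111\text{-}1$ if there are indices $p$ and $q\ge p+3$ with $w_p=w_{p+1}=w_{p+2}=w_q$; otherwise it avoids it. $a_{111\text{-}1}(n,k)$ is the number of words in $[k]^n$ avoiding $111\text{-}1$ (with $a(0,k)=1$), and $W_{111\text{-}1}(x;k)=\sum_{n\ge0}a_{111\text{-}1}(n,k)x^n$. *)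

(* Defs.v *)
From HB Require Import structures.
From mathcomp Require Import all_boot all_order all_algebra.
From mathcomp Require Import boolp.

Set Implicit Arguments.
Unset Strict Implicit.
Unset Printing Implicit Defensive.

Import GRing.Theory.

Local Open Scope ring_scope.

(* The ring R[[x]] of formal power series. A record, rather than [nat -> R]
   itself, so that its product is the Cauchy product and not a pointwise one. *)
Record fps (R : Type) := Fps { fpscoef : nat -> R }.

Lemma fpsP (R : Type) (f g : fps R) : fpscoef f =1 fpscoef g -> f = g.
Proof. by case: f g => [f] [g] /= fg; congr Fps; apply: funext. Qed.

HB.instance Definition _ (R : Type) := gen_eqMixin (fps R).
HB.instance Definition _ (R : Type) := gen_choiceMixin (fps R).

Definition fps_zero (R : zmodType) : fps R := Fps (fun _ => 0).
Definition fps_opp (R : zmodType) (f : fps R) : fps R :=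
  Fps (fun n => - fpscoef f n).
Definition fps_add (R : zmodType) (f g : fps R) : fps R :=
  Fps (fun n => fpscoef f n + fpscoef g n).

Fact fps_addA (R : zmodType) : associative (@fps_add R).
Proof. by move=> f g h; apply: fpsP => n; apply: addrA. Qed.
Fact fps_addC (R : zmodType) : commutative (@fps_add R).
Proof. by move=> f g; apply: fpsP => n; apply: addrC. Qed.
Fact fps_add0 (R : zmodType) : left_id (@fps_zero R) (@fps_add R).
Proof. by move=> f; apply: fpsP => n; apply: add0r. Qed.
Fact fps_addN (R : zmodType) :
  left_inverse (@fps_zero R) (@fps_opp R) (@fps_add R).
Proof. by move=> f; apply: fpsP => n; apply: addNr. Qed.

HB.instance Definition _ (R : zmodType) :=
  GRing.isZmodule.Build (fps R)
    (@fps_addA R) (@fps_addC R) (@fps_add0 R) (@fps_addN R).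

Definition fps_one (R : comNzRingType) : fps R := Fps (fun n => (n == 0)%:R).
Definition fps_mul (R : comNzRingType) (f g : fps R) : fps R :=
  Fps (fun n => \sum_(i < n.+1) fpscoef f i * fpscoef g (n - i)).

Fact fps_mulC (R : comNzRingType) : commutative (@fps_mul R).
Proof.
move=> f g; apply: fpsP => n /=; rewrite (reindex_inj rev_ord_inj) /=.
by apply: eq_bigr => i _; rewrite subSS mulrC subKn // -ltnS.
Qed.

Fact fps_coef_mul_rev (R : comNzRingType) (f g : fps R) n :
  fpscoef (fps_mul f g) n = \sum_(i < n.+1) fpscoef f (n - i) * fpscoef g i.
Proof. by rewrite fps_mulC /=; apply: eq_bigr => i _; rewrite mulrC. Qed.

Fact fps_mulA (R : comNzRingType) : associative (@fps_mul R).
Proof.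
move=> p q r; apply: fpsP => i; rewrite [RHS]fps_coef_mul_rev [LHS]/=.
pose coef3 j k := fpscoef p j * (fpscoef q (i - j - k) * fpscoef r k).
transitivity (\sum_(j < i.+1) \sum_(k < i.+1 | (k <= i - j)%N) coef3 j k).
  apply: eq_bigr => /= j _.
  rewrite -[X in _ * X]/(fpscoef (fps_mul q r) (i - j)) fps_coef_mul_rev.
  by rewrite big_distrr /= (big_ord_narrow_leq (leq_subr _ _)).
rewrite (exchange_big_dep predT) //=; apply: eq_bigr => k _.
transitivity (\sum_(j < i.+1 | (j <= i - k)%N) coef3 j k).
  apply: eq_bigl => j; rewrite -ltnS -(ltnS j) -!subSn ?leq_ord //.
  by rewrite -subn_gt0 -(subn_gt0 j) -!subnDA addnC.
rewrite (big_ord_narrow_leq (leq_subr _ _)) big_distrl /=.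
by apply: eq_bigr => j _; rewrite /coef3 -!subnDA addnC mulrA.
Qed.

Fact fps_mul1 (R : comNzRingType) : left_id (@fps_one R) (@fps_mul R).
Proof.
move=> f; apply: fpsP => n /=; rewrite big_ord_recl /= mul1r subn0.
by rewrite big1 ?addr0 // => i _; rewrite mul0r.
Qed.

Fact fps_mulDl (R : comNzRingType) :
  left_distributive (@fps_mul R) (@fps_add R).
Proof.
move=> f g h; apply: fpsP => n /=; rewrite -big_split /=.
by apply: eq_bigr => i _; rewrite mulrDl.
Qed.

Fact fps_one_neq0 (R : comNzRingType) : fps_one R != 0.
Proof.
by apply/eqP => /(congr1 (fun f => fpscoef f 0)) /eqP; rewrite /= oner_eq0.
Qed.

HB.instance Definition _ (R : comNzRingType) :=
  GRing.Zmodule_isComNzRing.Build (fps R)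
    (@fps_mulA R) (@fps_mulC R) (@fps_mul1 R) (@fps_mulDl R) (@fps_one_neq0 R).

(* The first n coefficients of 1 / f, from the recurrence
   f_0 g_m = [m = 0] - \sum_(i < m) f_(m - i) g_i. *)
Fixpoint fps_inv_seq (R : comUnitRingType) (f : fps R) (n : nat) : seq R :=
  if n is m.+1 then
    let s := fps_inv_seq f m in
    rcons s ((fpscoef f 0)^-1 *
             ((m == 0)%:R - \sum_(i < m) fpscoef f (m - i) * s`_i))
  else [::].

Definition fps_unit (R : comUnitRingType) : {pred fps R} :=
  [pred f | fpscoef f 0 \is a GRing.unit].

Definition fps_inv (R : comUnitRingType) (f : fps R) : fps R :=
  if f \in @fps_unit R then Fps (fun n => (fps_inv_seq f n.+1)`_n) else f.

Lemma size_fps_inv_seq (R : comUnitRingType) (f : fps R) n :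
  size (fps_inv_seq f n) = n.
Proof. by elim: n => //= n IHn; rewrite size_rcons IHn. Qed.

Lemma nth_fps_inv_seq (R : comUnitRingType) (f : fps R) n i :
  (i < n)%N -> (fps_inv_seq f n)`_i = (fps_inv_seq f i.+1)`_i.
Proof.
elim: n => // n IHn; rewrite ltnS leq_eqVlt => /predU1P[-> //|ltin].
by rewrite [LHS]/= nth_rcons size_fps_inv_seq ltin IHn.
Qed.

Fact fps_mulV (R : comUnitRingType) :
  {in @fps_unit R, left_inverse 1 (@fps_inv R) *%R}.
Proof.
move=> f Uf; apply: fpsP => n; rewrite /fps_inv Uf mulrC.
rewrite [LHS]fps_coef_mul_rev big_ord_recr subnn.
have -> : fpscoef f 0 * (fps_inv_seq f n.+1)`_n =
    (n == 0)%:R - \sum_(i < n) fpscoef f (n - i) * (fps_inv_seq f i.+1)`_i.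
  rewrite [fps_inv_seq _ _]/= nth_rcons size_fps_inv_seq ltnn eqxx mulVKr //.
  congr (_ - _); apply: eq_bigr => i _.
  by rewrite (nth_fps_inv_seq f (ltn_ord i)).
exact: etrans (addrC _ _) (subrK _ _).
Qed.

Fact fps_unitP (R : comUnitRingType) (f g : fps R) :
  g * f = 1 -> @fps_unit R f.
Proof.
move=> /(congr1 (fun h => fpscoef h 0)) /=; rewrite big_ord1 subn0 => gf1.
by apply/unitrPr; exists (fpscoef g 0); rewrite mulrC.
Qed.

Fact fps_inv_out (R : comUnitRingType) :
  {in [predC @fps_unit R], @fps_inv R =1 id}.
Proof. by move=> f; rewrite inE /fps_inv => /negbTE ->. Qed.

HB.instance Definition _ (R : comUnitRingType) :=
  GRing.ComNzRing_hasMulInverse.Build (fps R)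
    (@fps_mulV R) (@fps_unitP R) (@fps_inv_out R).

Lemma fps_unitE (R : comUnitRingType) (f : fps R) :
  (f \is a GRing.unit) = (fpscoef f 0 \is a GRing.unit).
Proof. by []. Qed.

Definition fpsX (R : comNzRingType) : fps R := Fps (fun n => (n == 1)%:R).
Arguments fpsX {R}.

(* Positions are counted from 0. As p + 3 <= q < size w, all four positions
   are valid, so [onth] never returns [None] here. *)
Definition contains_111_1 (T : eqType) (w : seq T) : bool :=
  [exists p : 'I_(size w), [exists q : 'I_(size w),
    [&& (p + 3 <= q)%N, onth w p == onth w p.+1,
        onth w p.+1 == onth w p.+2 & onth w p.+2 == onth w q]]].

(* The alphabet {1, ..., k} is represented by 'I_k = {0, ..., k - 1}. *)
Definition a_111_1 (n k : nat) : nat :=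
  #|[set w : n.-tuple 'I_k | ~~ contains_111_1 w]|.

Definition W_111_1 (k : nat) : fps int := Fps (fun n => (a_111_1 n k)%:R).

(* Denominators of the closed form of W_111_1: dividing by them is genuine
   division, as they are invertible in Z[[x]]. *)
Lemma W_den_unit (j k : nat) :
  \prod_(j <= i < k.+1) (1 - (i%:R - 1) * (fpsX * (1 + fpsX)))
    \is a @GRing.unit (fps int).
Proof.
apply: rpred_prod => i _; rewrite fps_unitE.
suff -> (f g : fps int) : fpscoef (1 - f * (fpsX * g)) 0 = 1 by rewrite unitr1.
by rewrite mulrCA /= big_ord1 mul0r subr0.
Qed.

(* Main.v *)
Require Import Defs.
From HB Require Import structures.
From mathcomp Require Import all_boot all_order all_algebra.
From mathcomp Require Import zify ring.

Set Implicit Arguments.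
Unset Strict Implicit.
Unset Printing Implicit Defensive.

Import GRing.Theory.

Local Open Scope ring_scope.

(** Split an avoiding word according to its first run, of some letter [a].
    If the run has length 1 or 2, what follows is empty or an arbitrary avoiding
    word not starting with [a]; otherwise the run has length exactly 3 and what
    follows is an arbitrary avoiding word on the other letters. With
    [r = x (1 + x)] this gives [W_0 = 1] and
    [(1 - k r) W_(k+1) = 1 + r + (k + 1) x^3 W_k], a first-order linear
    recurrence in [k]. It is solved from [k = 1] on, where [W_0 = 1] contributes
    the exceptional [x^3] of the term [j = 1]. *)

Lemma contains_111_1P (T : eqType) (w : seq T) :
  reflect (exists p q, [/\ (p + 3 <= q < size w)%N, onth w p = onth w p.+1,
             onth w p.+1 = onth w p.+2 & onth w p.+2 = onth w q])
          (contains_111_1 w).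
Proof.
apply: (iffP existsP) => [[p /existsP[q /and4P[lepq /eqP ? /eqP ? /eqP ?]]]|].
  by exists p, q; rewrite lepq ltn_ord.
move=> [p [q [/andP[lepq ltq] e0 e1 e2]]].
have ltp : (p < size w)%N by lia.
exists (Ordinal ltp); apply/existsP; exists (Ordinal ltq).
by apply/and4P; split=> //; apply/eqP.
Qed.

Lemma contains_111_1_short (T : eqType) (w : seq T) :
  (size w <= 3)%N -> contains_111_1 w = false.
Proof. by move=> sw; apply/contains_111_1P => -[p [q []]]; lia. Qed.

Lemma contains_111_1_cons (T : eqType) (a : T) (w : seq T) :
  contains_111_1 (a :: w) =
  prefix [:: a; a] w && (a \in drop 2 w) || contains_111_1 w.
Proof.
case: w => [|b [|c w]].
- by rewrite !contains_111_1_short.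
- by rewrite !contains_111_1_short //= andbF.
rewrite /= prefix0s andbT drop0.
apply/contains_111_1P/orP => [[[|p] [[|q] []]] //=|].
- case: q => [|[|q]] //= _ [->] [->] /esym w_q.
  by left; rewrite !eqxx; apply/onthP; exists q.
- by move=> lepq e0 e1 e2; right; apply/contains_111_1P; exists p, q.
case=> [/andP[/andP[/eqP <- /eqP <-] /onthP[q w_q]]|].
  by exists 0%N, q.+3; split=> //=; rewrite !ltnS -onthTE w_q.
by case/contains_111_1P => p [q [lepq ? ? ?]]; exists p.+1, q.+1.
Qed.

Lemma contains_111_1_short_run (T : eqType) (a : T) (w : seq T) m :
  (m <= 2)%N -> ohead w != Some a ->
  contains_111_1 (nseq m a ++ w) = contains_111_1 w.
Proof.
have [->|] := eqVneq w [::].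
  by move=> le_m2 _; rewrite cats0 !contains_111_1_short // size_nseq; lia.
case: w => // b w _ le_m2; rewrite (inj_eq Some_inj) => /negbTE ba.
by case: m le_m2 => [|[|[|m]]] //= _;
  rewrite !contains_111_1_cons /= eq_sym ba ?andbF.
Qed.

Lemma contains_111_1_run3 (T : eqType) (a : T) (w : seq T) :
  contains_111_1 [:: a, a, a & w] = (a \in w) || contains_111_1 w.
Proof.
rewrite contains_111_1_cons /= !eqxx prefix0s drop0 /=.
have [//|aNw] := boolP (a \in w).
rewrite (@contains_111_1_short_run _ a w 2) //.
by case: w aNw => //= b w; rewrite inE negb_or eq_sym => /andP[].
Qed.

Lemma contains_111_1_map (T U : eqType) (f : T -> U) (w : seq T) :
  injective f -> contains_111_1 (map f w) = contains_111_1 w.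
Proof.
move=> f_inj; elim: w => [|a w IHw]; first by rewrite !contains_111_1_short.
rewrite /= !contains_111_1_cons IHw -map_drop mem_map //.
by rewrite !prefixE -map_take (inj_eq (inj_map f_inj) _ [:: a; a]).
Qed.

Local Open Scope nat_scope.

Lemma card_tuple_cons (T : finType) n (P : pred (seq T)) :
  #|[set w : n.+1.-tuple T | P w]| =
  \sum_(a : T) #|[set w : n.-tuple T | P (a :: w)]|.
Proof.
under eq_bigr do rewrite -sum1dep_card.
rewrite -sum1dep_card pair_big_dep /=.
rewrite (reindex (fun u : T * n.-tuple T => [tuple of u.1 :: u.2])) //=.
exists (fun w : n.+1.-tuple T => (thead w, [tuple of behead w])).
  by move=> [a w] _; rewrite theadE; congr pair; apply: val_inj.
by move=> w _; rewrite /= -tuple_eta.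
Qed.

Lemma card_tuple_split_head (T : finType) (a : T) n (P : pred (seq T)) :
  #|[set w : n.+1.-tuple T | P w]| =
  #|[set w : n.+1.-tuple T | (ohead w != Some a) && P w]|
  + #|[set w : n.-tuple T | P (a :: w)]|.
Proof.
rewrite (card_tuple_cons _ (fun w => (ohead w != Some a) && P w)).
rewrite card_tuple_cons (bigD1 a) //= addnC; congr (_ + _).
rewrite [RHS](bigD1 a) //= eqxx cards0 add0n.
by apply: eq_bigr => b ba; rewrite (inj_eq Some_inj) ba.
Qed.

Lemma sum_card_tuple_head_neq (T : finType) n (P : pred (seq T)) :
  \sum_(a : T) #|[set w : n.+1.-tuple T | (ohead w != Some a) && P w]| =
  #|T|.-1 * #|[set w : n.+1.-tuple T | P w]|.
Proof.
under eq_bigr do rewrite -sum1dep_card.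
rewrite (exchange_big_dep (fun w : n.+1.-tuple T => P w)) => [|? ? _ /andP[]//].
rewrite mulnC -sum_nat_cond_const; apply: eq_bigr => w Pw.
case/tupleP: w Pw => b w Pw; rewrite -(cardC1 b) -sum1_card.
by apply: eq_bigl => a; rewrite Pw andbT /= (inj_eq Some_inj) eq_sym.
Qed.

Lemma card_tuple_map (T U : finType) (f : U -> T) n (P : pred (seq T)) :
  injective f ->
  #|[set w : n.-tuple T | all (mem (codom f)) w && P w]| =
  #|[set w : n.-tuple U | P (map f w)]|.
Proof.
move=> f_inj; have map_tuple_inj : injective (@map_tuple n _ _ f).
  by move=> u v /(congr1 val) /(inj_map f_inj) /val_inj.
rewrite -(card_imset _ map_tuple_inj); apply: eq_card => w; rewrite inE.
apply/andP/imsetP => [[/allP w_codom Pw]|[u]]; last first.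
  rewrite inE => Pu ->; split=> //.
  by apply/allP => _ /mapP[x _ ->]; apply: codom_f.
have w_codom_f i : tnth w i \in codom f by apply: w_codom; apply: mem_tnth.
pose u := [tuple iinv (w_codom_f i) | i < n].
have def_w : w = map_tuple f u.
  by apply: eq_from_tnth => i; rewrite tnth_map tnth_mktuple f_iinv.
by exists u; rewrite // inE -[map f u]/(val (map_tuple f u)) -def_w.
Qed.

Lemma all_codom_lift n (a : 'I_n.+1) (w : seq 'I_n.+1) :
  all (mem (codom (lift a))) w = (a \notin w).
Proof.
rewrite -has_pred1 -all_predC; apply: eq_all => b /=.
case: (unliftP a b) => [c ->|->]; first by rewrite codom_f eq_sym neq_lift.
by rewrite eqxx; apply/codomP => -[c /eqP]; rewrite (negbTE (neq_lift a c)).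
Qed.

Lemma a_111_1_short n k : n <= 3 -> a_111_1 n k = k ^ n.
Proof.
move=> le_n3; rewrite -[in RHS](card_ord k) -card_tuple -cardsT.
by apply: eq_card => w; rewrite !inE contains_111_1_short ?size_tuple.
Qed.

Lemma a_111_1_0 n : a_111_1 n 0 = (n == 0).
Proof.
case: n => [|n]; first by rewrite a_111_1_short.
by rewrite /a_111_1 (card_tuple_cons _ (predC (@contains_111_1 _))) big_ord0.
Qed.

Lemma sum_card_after_short_run (T : finType) m n :
  m <= 2 ->
  \sum_(a : T) #|[set w : n.+1.-tuple T |
      (ohead w != Some a) && ~~ contains_111_1 (nseq m a ++ w)]| =
  #|T|.-1 * #|[set w : n.+1.-tuple T | ~~ contains_111_1 w]|.
Proof.
move=> le_m2; rewrite -(sum_card_tuple_head_neq _ (predC (@contains_111_1 _))).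
apply: eq_bigr => a _; apply: eq_card => w; rewrite !inE.
by apply: andb_id2l => w_a; rewrite contains_111_1_short_run.
Qed.

Lemma card_after_run3 n k (a : 'I_k.+1) :
  #|[set w : n.-tuple 'I_k.+1 | ~~ contains_111_1 [:: a, a, a & w]]| =
  a_111_1 n k.
Proof.
transitivity #|[set w : n.-tuple 'I_k |
                 ~~ contains_111_1 (map (lift a) w)]|; last first.
  by apply: eq_card => w; rewrite !inE contains_111_1_map //; apply: lift_inj.
rewrite -(card_tuple_map _ (predC (@contains_111_1 _)) (@lift_inj _ a)).
by apply: eq_card => w; rewrite !inE all_codom_lift contains_111_1_run3 negb_or.
Qed.

Lemma a_111_1_rec n k :
  a_111_1 n.+3 k.+1 =
  k * a_111_1 n.+2 k.+1 + k * a_111_1 n.+1 k.+1 + k.+1 * a_111_1 n k.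
Proof.
rewrite {1}/a_111_1 (card_tuple_cons _ (predC (@contains_111_1 _))) /=.
under eq_bigr => a _ do
  rewrite (card_tuple_split_head a _ (fun w => ~~ contains_111_1 (a :: w)))
          (card_tuple_split_head a _ (fun w => ~~ contains_111_1 [:: a, a & w]))
          card_after_run3 addnA.
rewrite 2!big_split /= sum_nat_const card_ord; congr (_ + _ + _).
  by rewrite (@sum_card_after_short_run _ 1) // card_ord.
by rewrite (@sum_card_after_short_run _ 2) // card_ord.
Qed.

Lemma prod_nat_fact_bin j k :
  j <= k -> \prod_(j.+1 <= i < k.+1) i = (k - j)`! * 'C(k, j).
Proof.
move=> le_jk; apply/eqP; rewrite -(eqn_pmul2l (fact_gt0 j)); apply/eqP.
by rewrite [RHS]mulnA [RHS]mulnC bin_fact // !fact_prod -big_cat_nat.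
Qed.

Local Open Scope ring_scope.

Lemma fpscoefD (R : zmodType) (f g : fps R) n :
  fpscoef (f + g) n = fpscoef f n + fpscoef g n.
Proof. by []. Qed.

Lemma fpscoefMn (R : zmodType) (f : fps R) m n :
  fpscoef (f *+ m) n = fpscoef f n *+ m.
Proof. by elim: m => [|m IHm]; rewrite ?mulr0n // !mulrS fpscoefD IHm. Qed.

Lemma fpscoefXM (R : comNzRingType) (f : fps R) n :
  fpscoef (fpsX * f) n = if n is m.+1 then fpscoef f m else 0.
Proof.
case: n => [|n]; first by rewrite /= big_ord1 mul0r.
rewrite /= !big_ord_recl mul0r add0r mul1r subn1 /=.
by rewrite big1 ?addr0 // => i _; rewrite mul0r.
Qed.

Lemma W_111_1_0 : W_111_1 0 = 1.
Proof. by apply: fpsP => n; rewrite /= a_111_1_0. Qed.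

Lemma W_111_1_rec k :
  (1 - (k.+1%:R - 1) * (fpsX * (1 + fpsX))) * W_111_1 k.+1 =
  1 + fpsX * (1 + fpsX) + k.+1%:R * fpsX ^+ 3 * W_111_1 k.
Proof.
(* In Horner form, the coefficients are read off by [fpscoefXM] alone. *)
suff WE : W_111_1 k.+1 =
    1 + fpsX * (1 + fpsX * 1)
    + (fpsX * (W_111_1 k.+1 + fpsX * W_111_1 k.+1)) *+ k
    + (fpsX * (fpsX * (fpsX * W_111_1 k))) *+ k.+1.
  by rewrite -natr1 addrK mulrBl mul1r [X in X - _]WE; ring.
apply: fpsP => n; rewrite !(fpscoefD, fpscoefMn, fpscoefXM).
case: n => [|[|[|n]]]; rewrite ?(fpscoefD, fpscoefXM) /=.
- by rewrite a_111_1_short //; ring.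
- by rewrite !a_111_1_short //; ring.
- by rewrite !a_111_1_short //; ring.
- by rewrite a_111_1_rec; ring.
Qed.

Lemma linear_recurrence_sol (R : comUnitRingType) (d b c u : nat -> R) m k :
  (forall i, d i \is a GRing.unit) ->
  d m * u m = b m ->
  (forall i, (m <= i)%N -> d i.+1 * u i.+1 = b i.+1 + c i.+1 * u i) ->
  (m <= k)%N ->
  u k = \sum_(m <= j < k.+1)
          b j * \prod_(j.+1 <= i < k.+1) c i / \prod_(j <= i < k.+1) d i.
Proof.
move=> d_unit u_m u_rec le_mk.
have D_unit j n : \prod_(j <= i < n) d i \is a GRing.unit by apply: rpred_prod.
rewrite -(subnKC le_mk); elim: (k - m)%N => [|l IHl].
  by rewrite addn0 !big_nat1 big_geq // mulr1 -u_m mulrC mulKr.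
have le_m_ml : (m <= m + l)%N by apply: leq_addr.
rewrite addnS; move: (m + l)%N le_m_ml IHl => {}k {}le_mk IHk.
apply: (mulrI (d_unit k.+1)); rewrite u_rec // IHk.
rewrite [in RHS]big_nat_recr ?leqW //= mulrDr addrC; congr (_ + _); last first.
  by rewrite big_nat1 big_geq // mulr1 mulrC divrK.
rewrite !big_distrr /=; apply: eq_big_nat => j /andP[_ lt_jk].
rewrite !(big_nat_recr k.+1) ?(ltnW lt_jk) //= invrM //.
by rewrite -[LHS](mulVKr (d_unit k.+1)); ring.
Qed.

Theorem theorem4p2 (k : nat) (hk : (1 <= k)%N) :
  W_111_1 k =
  \sum_(1 <= j < k.+1)
    ((k - j)`! * 'C(k, j))%:R
      * (1 + fpsX * (1 + fpsX) + (j == 1%N)%:R * fpsX ^+ 3)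
      * fpsX ^+ (3 * (k - j))
    / \prod_(j <= i < k.+1) (1 - (i%:R - 1) * (fpsX * (1 + fpsX))).
Proof.
pose d i : fps int := 1 - (i%:R - 1) * (fpsX * (1 + fpsX)).
pose b j : fps int := 1 + fpsX * (1 + fpsX) + (j == 1%N)%:R * fpsX ^+ 3.
pose c i : fps int := i%:R * fpsX ^+ 3.
have d_unit i : d i \is a GRing.unit.
  by have := W_den_unit i i; rewrite big_nat1.
have W1 : d 1%N * W_111_1 1 = b 1%N by rewrite W_111_1_rec W_111_1_0 mulr1.
have W_rec i : (1 <= i)%N ->
    d i.+1 * W_111_1 i.+1 = b i.+1 + c i.+1 * W_111_1 i.
  by case: i => // i _; rewrite /b mul0r addr0 -W_111_1_rec.
rewrite (linear_recurrence_sol d_unit W1 W_rec hk).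
apply: eq_big_nat => j /andP[_ le_jk]; congr (_ / _).
rewrite big_split /= -natr_prod prodr_const_nat prod_nat_fact_bin //.
by rewrite subSS exprM mulrCA mulrA.
Qed.
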